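(* Let $0\le a<b$, $0<\alpha<1$, and let $f,g:[a,b]\to\mathbb{R}$ be functions that are (1) continuous on $[a,b]$ and (2) bounded and integrable on $[a,b]$. Suppose moreover that $g$ is nonnegative on $[a,b]$ (or nonpositive on $[a,b]$). Set $m=\inf\{f(x):x\in[a,b]\}$ and $M=\sup\{f(x):x\in[a,b]\}$. Then there exists a number $\xi\in[m,M]$ such that $$\int_a^b f(x)g(x)\,d_\omega x=\xi\int_a^b g(x)\,d_\omega x,$$ where $d_\omega x=\dfrac{\Gamma(\gamma+\beta)(\delta)_p}{\Gamma(\beta)(\rho)_q}\dfrac{dx}{x^{1-\alpha}}$. If $f$ is continuous on $[a,b]$, then there exists $x_0\in[a,b]$ such that $$\int_a^b f(x)g(x)\,d_\omega x=f(x_0)\int_a^b g(x)\,d_\omega x.$$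
   Context: Parameters: $\gamma,\beta,\rho,\delta\in\mathbb{C}$ with $\mathrm{Re}(\gamma),\mathrm{Re}(\beta),\mathrm{Re}(\rho),\mathrm{Re}(\delta)>0$ and real $p,q>0$ with $\mathrm{Re}(\gamma)+p\ge q$. For real $s\ge 0$, $(z)_s:=\Gamma(z+s)/\Gamma(z)$. *)

(* Defs.v *)
From mathcomp Require Import all_boot all_order all_algebra.
From mathcomp Require Import all_classical all_reals all_analysis.
From mathcomp Require Import complex.

Set Implicit Arguments.
Unset Strict Implicit.
Unset Printing Implicit Defensive.

Import Order.TTheory GRing.Theory Num.Theory.
Import numFieldNormedType.Exports.

Local Open Scope classical_set_scope.
Local Open Scope ring_scope.
Local Open Scope complex_scope.

(* Componentwise Lebesgue integral; meaningful when both components of [h] are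
   integrable on [D]. *)
Definition cintegral (R : realType) (D : set R) (h : R -> R[i]) : R[i] :=
  Rintegral lebesgue_measure D (fun x => complex.Re (h x)) +i*
  Rintegral lebesgue_measure D (fun x => complex.Im (h x)).

(* t^z = exp (z ln t) for t > 0, with the principal (real) logarithm. *)
Definition cpow (R : realType) (t : R) (z : R[i]) : R[i] :=
  (t `^ complex.Re z)%:C *
  (cos (complex.Im z * ln t) +i* sin (complex.Im z * ln t)).

(* Euler's integral, the Gamma function on the half-plane Re z > 0; it is not
   continued analytically to the rest of the plane. *)
Definition cGamma (R : realType) (z : R[i]) : R[i] :=
  cintegral `]0, +oo[ (fun t => cpow t (z - 1) * (expR (- t))%:C).

Definition cpoch (R : realType) (z : R[i]) (s : R) : R[i] :=
  cGamma (z + s%:C) / cGamma z.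

(* The (complex) density of d_omega x with respect to dx.  At x = 0 it takes
   the value 0 (inverse of 0), which does not affect integrals. *)
Definition omega_density (R : realType) (gam bet rho del : R[i])
    (p q alpha : R) (x : R) : R[i] :=
  cGamma (gam + bet) * cpoch del p / (cGamma bet * cpoch rho q) *
  ((x `^ (1 - alpha))^-1)%:C.

Definition omega_integral (R : realType) (gam bet rho del : R[i])
    (p q alpha : R) (a b : R) (h : R -> R) : R[i] :=
  cintegral `[a, b]
    (fun x => (h x)%:C * omega_density gam bet rho del p q alpha x).

(* Main.v *)
(* The complex constant in d_omega x factors out of both integrals, so its
   value (and with it the Gamma function) is irrelevant: what remains is the
   real mean value theorem for the weight g(x) x^(alpha-1), which has constant
   sign. The weight is integrable on [a, b] even when a = 0, because
   x^(alpha-1) has the antiderivative x^alpha / alpha, which is bounded near 0;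
   the ratio of the two integrals then lies between the minimum and the maximum
   of f and is attained by the intermediate value theorem. *)
Require Import Defs.
From mathcomp Require Import all_boot all_order all_algebra.
From mathcomp Require Import all_classical all_reals all_analysis.
From mathcomp Require Import measurable_realfun complex.

Import Order.TTheory GRing.Theory Num.Theory.
Import numFieldNormedType.Exports.

Local Open Scope classical_set_scope.
Local Open Scope ring_scope.
Local Open Scope complex_scope.

Section real_lemmas.
Context {R : realType}.
Local Notation mu := (@lebesgue_measure R).

Lemma derivable_powR_pos (r x : R) : 0 < x -> derivable (@powR R ^~ r) x 1.
Proof. by move=> x0; apply: ex_derive; exact: is_derive1_powR. Qed.

Lemma powR_within_continuous (r c b : R) : 0 < c ->
  {within `[c, b], continuous (@powR R ^~ r)}.
Proof.
move=> c0; apply: derivable_within_continuous => x.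
rewrite in_itv/= => /andP[cx _].
by apply: derivable_powR_pos; apply: lt_le_trans cx.
Qed.

(** Since [0 < c], the interval avoids the possible singularity at 0 and the fundamental theorem of
    calculus applies. *)
Lemma integral_powR_itvcc (r c b : R) : 0 < r -> 0 < c -> c < b ->
  (\int[mu]_(x in `[c, b]) (x `^ (r - 1))%:E =
     (r^-1 * b `^ r - r^-1 * c `^ r)%:E)%E.
Proof.
move=> r0 c0 cb.
have cF : {within `[c, b], continuous (fun x : R => r^-1 * x `^ r)}.
  move=> x; apply: cvgM; first exact: cvg_cst.
  exact: powR_within_continuous.
rewrite (@continuous_FTC2 _ _ (fun x => r^-1 * x `^ r)) ?EFinB//.
- exact: powR_within_continuous.
- have [cF1 cF2 cF3] := (continuous_within_itvP _ cb).1 cF.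
  split=> // x; rewrite in_itv/= => /andP[cx _].
  by apply: derivableM => //; apply: derivable_powR_pos; apply: lt_trans cx.
- move=> x; rewrite in_itv/= => /andP[cx _].
  have x0 : 0 < x by apply: lt_trans cx.
  rewrite derive1E deriveM//; last exact: derivable_powR_pos.
  have [_ ->] := is_derive1_powR r x0.
  by rewrite derive_cst scaler0 addr0 scalerA mulVf ?gt_eqF// scale1r.
Qed.

Lemma integrable_powR_itv0c (r b : R) : 0 < r -> 0 < b ->
  mu.-integrable `[0, b] (EFin \o (fun x => x `^ (r - 1))).
Proof.
move=> r0 b0.
have mw (D : set R) : measurable_fun D (EFin \o (fun x : R => x `^ (r - 1))).
  by apply/measurable_EFinP; apply: measurable_funTS; exact: measurable_powR.
apply/integrableP; split; first exact: mw.
under eq_integral do rewrite abse_EFin ger0_norm ?powR_ge0//.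
rewrite -integral_itv_obnd_cbnd; last exact: mw.
(* The shift to [n.+2] keeps the left end strictly below [b] even for [n = 0]. *)
pose F (n : nat) : set R := `[b / n.+2%:R, b]%classic.
have bn n : 0 < b / n.+2%:R < b.
  by rewrite divr_gt0//= gtr_pMr// invf_lt1 ?ltr1n.
have -> : `]0, b]%classic = \bigcup_n F n.
  apply/seteqP; split=> x /=.
    rewrite in_itv/= => /andP[x0 xb].
    (* With [n] the integer part of [b / x], one has [b / x < n + 1 <= n + 2], hence
       [b / (n + 2) <= x]. *)
    exists (Num.truncn (b / x)) => //; rewrite /F/= in_itv/= xb andbT.
    rewrite ler_pdivrMr// mulrC -ler_pdivrMr//.
    by rewrite (le_trans (ltW (truncnS_gt _)))// ler_nat.
  by move=> [n _]; rewrite /F/= !in_itv/= => /andP[cx ->]; rewrite andbT;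
    apply: lt_le_trans cx; case/andP: (bn n).
have nF : nondecreasing_seq F.
  move=> m n mn; rewrite subsetEset; apply: subset_itvr.
  by rewrite bnd_simp ler_pM2l// lef_pV2 ?posrE// ler_nat !ltnS.
apply: (@le_lt_trans _ _ (r^-1 * b `^ r)%:E); last exact: ltry.
have := @ge0_nondecreasing_set_cvg_integral _ (measurableTypeR R) R F
  (EFin \o (fun x => x `^ (r - 1))) mu nF.
move=> /(_ _ _ _)/cvge_to_le; apply.
- by move=> n; exact: measurable_itv.
- by move=> n; exact: mw.
- by move=> n x _; rewrite lee_fin powR_ge0.
near=> n; have /andP[c0 cb] := bn n.
rewrite integral_powR_itvcc// lee_fin gerBl mulr_ge0 ?powR_ge0//.
by rewrite invr_ge0 ltW.
Unshelve. all: end_near. Qed.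

Lemma integrable_powR_itvcc (r a b : R) : 0 < r -> 0 <= a -> a < b ->
  mu.-integrable `[a, b] (EFin \o (fun x => x `^ (r - 1))).
Proof.
move=> r0 a0 ab; apply: (@integrableS _ _ _ mu `[0, b] `[a, b]) => //; last first.
  by apply: integrable_powR_itv0c => //; exact: le_lt_trans ab.
by apply: subset_itvr; rewrite bnd_simp.
Qed.

(** By compactness [f] is bounded on [[a, b]], and a bounded measurable factor preserves
    integrability. *)
Lemma integrableM_continuous (a b : R) (f u : R -> R) :
  {within `[a, b], continuous f} ->
  mu.-integrable `[a, b] (EFin \o u) ->
  mu.-integrable `[a, b] (EFin \o (fun x => f x * u x)).
Proof.
move=> cf iu.
have -> : EFin \o (fun x => f x * u x) = ((EFin \o f) \* (EFin \o u))%E by [].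
apply: integrableMr => //.
  exact: subspace_continuous_measurable_fun.
have /compact_bounded[M [_ mrt]] := continuous_compact cf (@segment_compact _ a b).
by exists M; split; rewrite ?num_real// => ? ? ? ?; exact: mrt.
Qed.

Lemma integral_mean_value_ge0 (a b : R) (f u : R -> R) : a <= b ->
  {within `[a, b], continuous f} ->
  mu.-integrable `[a, b] (EFin \o u) ->
  (forall x, x \in `[a, b] -> 0 <= u x) ->
  exists2 x0, x0 \in `[a, b] &
    \int[mu]_(x in `[a, b]) (f x * u x) =
    f x0 * \int[mu]_(x in `[a, b]) u x.
Proof.
move=> ab cf iu u0.
have [c cab fc] := EVT_min ab cf.
have [d dab fd] := EVT_max ab cf.
have ifu := integrableM_continuous _ _ _ _ cf iu.
have icu k : mu.-integrable `[a, b] (EFin \o (fun x => k * u x)).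
  exact: (integrableZl _ k iu).
set J := \int[mu]_(x in _) u x; set K := \int[mu]_(x in _) (f x * u x).
have J0 : 0 <= J by apply: Rintegral_ge0 => x /u0.
have cK : f c * J <= K.
  rewrite /J /K -RintegralZl//; apply: le_Rintegral => //.
  by move=> x xab; rewrite ler_wpM2r ?u0 ?fc.
have Kd : K <= f d * J.
  rewrite /J /K -RintegralZl//; apply: le_Rintegral => //.
  by move=> x xab; rewrite ler_wpM2r ?u0 ?fd.
(* If [J = 0], the two bounds squeeze [K] to 0 and any point works; otherwise [K / J] lies between
   the extreme values of [f]. *)
have [J_eq0|JN0] := eqVneq J 0.
  exists c => //; apply/eqP; rewrite eq_le cK andbT.
  by rewrite J_eq0 mulr0; move: Kd; rewrite J_eq0 mulr0.
have Jgt0 : 0 < J by rewrite lt_neqAle eq_sym JN0.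
have cKJ : f c <= K / J by rewrite ler_pdivlMr.
have KJd : K / J <= f d by rewrite ler_pdivrMr.
have sub (x y : R) : x \in `[a, b] -> y \in `[a, b] -> `[x, y] `<=` `[a, b].
  rewrite !in_itv/= => /andP[ax _] /andP[_ yb].
  by apply: subset_itv; rewrite bnd_simp.
suff [x0 x0ab f0] : exists2 x0, x0 \in `[a, b] & f x0 = K / J.
  by exists x0 => //; rewrite f0 divfK.
(* The minimum may be attained to the left or to the right of the maximum, and the intermediate
   value theorem needs ordered endpoints. *)
have [cd|/ltW dc] := leP c d.
- have [] := @IVT _ f c d (K / J) cd.
  + exact: continuous_subspaceW (sub _ _ cab dab) cf.
  + by rewrite ge_min cKJ le_max KJd orbT.
  + by move=> x0 x0cd f0; exists x0 => //; apply: (sub c d).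
- have [] := @IVT _ f d c (K / J) dc.
  + exact: continuous_subspaceW (sub _ _ dab cab) cf.
  + by rewrite ge_min cKJ orbT le_max KJd.
  + by move=> x0 x0cd f0; exists x0 => //; apply: (sub d c).
Qed.

Lemma integral_mean_value (a b : R) (f u : R -> R) : a <= b ->
  {within `[a, b], continuous f} ->
  mu.-integrable `[a, b] (EFin \o u) ->
  (forall x, x \in `[a, b] -> 0 <= u x) \/
    (forall x, x \in `[a, b] -> u x <= 0) ->
  exists2 x0, x0 \in `[a, b] &
    \int[mu]_(x in `[a, b]) (f x * u x) =
    f x0 * \int[mu]_(x in `[a, b]) u x.
Proof.
move=> ab cf iu [u0|u0]; first exact: integral_mean_value_ge0.
(* Negate the weight; the form [-1 * u x] lets the sign leave both integrals as a scalar. *)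
have [||x0 x0ab E] := @integral_mean_value_ge0 a b f (fun x => -1 * u x) ab cf.
- exact: (integrableZl _ (-1) iu).
- by move=> x xab; rewrite mulN1r oppr_ge0 u0.
exists x0 => //; move: E.
under eq_Rintegral do rewrite mulrCA.
rewrite !RintegralZl//; last exact: integrableM_continuous.
by rewrite !mulN1r mulrN => /oppr_inj.
Qed.

End real_lemmas.

(** Real and imaginary parts of the integrand are constant multiples of one real integrable
    function, so the integral is a complex constant times a real integral. *)
Lemma omega_integralE (R : realType) (gam bet rho del : R[i])
    (p q alpha a b : R) (h : R -> R) :
  0 < alpha -> 0 <= a -> a < b -> {within `[a, b], continuous h} ->
  omega_integral gam bet rho del p q alpha a b h =
  cGamma (gam + bet) * cpoch del p / (cGamma bet * cpoch rho q) *
  (\int[lebesgue_measure]_(x in `[a, b]) (h x * x `^ (alpha - 1)))%:C.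
Proof.
move=> alpha0 a0 ab ch; rewrite /omega_integral /omega_density /cintegral.
move: (_ / _) => k; set w := fun x : R => h x * x `^ (alpha - 1).
have iw : lebesgue_measure.-integrable `[a, b] (EFin \o w).
  by apply: integrableM_continuous => //; exact: integrable_powR_itvcc.
have wE x : (h x)%:C * (k * ((x `^ (1 - alpha))^-1)%:C) =
    (complex.Re k * w x) +i* (complex.Im k * w x).
  (* Inverting the power negates its exponent, also at [x = 0], where the inverse of 0 is 0. *)
  rewrite /w -powRN opprB mulrCA -rmorphM/=; case: k => u v /=.
  by simpc.
transitivity (
    (\int[lebesgue_measure]_(x in `[a, b]) (complex.Re k * w x)) +i*
    (\int[lebesgue_measure]_(x in `[a, b]) (complex.Im k * w x))).
  by congr (_ +i* _); congr Rintegral; apply/funext => x; rewrite wE.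
rewrite !RintegralZl// {wE}; case: k => u v /=.
by simpc.
Qed.

Theorem theorem16 (R : realType) (gam bet rho del : R[i]) (p q : R)
  (gam_gt0 : 0 < complex.Re gam) (bet_gt0 : 0 < complex.Re bet)
  (rho_gt0 : 0 < complex.Re rho) (del_gt0 : 0 < complex.Re del)
  (p_gt0 : 0 < p) (q_gt0 : 0 < q) (q_le : q <= complex.Re gam + p)
  (a b alpha : R) (a_ge0 : 0 <= a) (ab : a < b)
  (alpha_gt0 : 0 < alpha) (alpha_lt1 : alpha < 1)
  (f g : R -> R)
  (f_cont : {within `[a, b], continuous f})
  (g_cont : {within `[a, b], continuous g})
  (f_bnd : [bounded f x | x in `[a, b]])
  (g_bnd : [bounded g x | x in `[a, b]])
  (f_int : lebesgue_measure.-integrable `[a, b] (EFin \o f))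
  (g_int : lebesgue_measure.-integrable `[a, b] (EFin \o g))
  (g_sign : (forall x, x \in `[a, b] -> 0 <= g x) \/
            (forall x, x \in `[a, b] -> g x <= 0)) :
  let m := inf [set f x | x in `[a, b]] in
  let M := sup [set f x | x in `[a, b]] in
  let I := omega_integral gam bet rho del p q alpha a b in
  (exists xi : R, [/\ m <= xi, xi <= M &
     I (fun x => f x * g x) = xi%:C * I g]) /\
  ({within `[a, b], continuous f} ->
   exists x0 : R, x0 \in `[a, b] /\
     I (fun x => f x * g x) = (f x0)%:C * I g).
Proof.
move=> m M I.
have cfg : {within `[a, b], continuous (fun x => f x * g x)}.
  by move=> x; apply: cvgM; [exact: f_cont|exact: g_cont].
(* The power of [x] goes into the weight, which keeps the sign of [g] because powers are
   nonnegative. *)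
have [||x0 x0ab E] := @integral_mean_value R a b f
    (fun x => g x * x `^ (alpha - 1)) (ltW ab) f_cont.
- apply: integrableM_continuous => //.
  exact: integrable_powR_itvcc.
- by case: g_sign => s; [left|right] => x xab;
    rewrite ?mulr_ge0 ?mulr_le0_ge0 ?powR_ge0 ?s.
have IE : I (fun x => f x * g x) = (f x0)%:C * I g.
  rewrite /I !omega_integralE// [RHS]mulrCA -rmorphM/= -E.
  by congr (_ * _%:C); apply: eq_Rintegral => x _; rewrite mulrA.
split; last by move=> _; exists x0.
(* The value [f x0] also serves as [xi]; the extrema show that the set of values is bounded, so [m]
   and [M] are true bounds. *)
have [c cab fc] := EVT_min (ltW ab) f_cont.
have [d dab fd] := EVT_max (ltW ab) f_cont.
exists (f x0); split=> //.
- by apply: ge_inf; [exists (f c) => _ [x xab <-]; exact: fc|exists x0].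
- by apply: ub_le_sup; [exists (f d) => _ [x xab <-]; exact: fd|exists x0].
Qed.
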